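(* Let $A,N_1,\dots,N_q\in\mathbb R^{n\times n}$, $X_0\in\mathbb R^{n\times m}$, $C\in\mathbb R^{p\times n}$ be the coefficients of the original system and $\hat A,\hat N_1,\dots,\hat N_q\in\mathbb R^{\hat n\times\hat n}$, $\hat X_0\in\mathbb R^{\hat n\times m}$, $\hat C\in\mathbb R^{p\times\hat n}$ those of the reduced system, and let $T>0$. Suppose that the reduced coefficients $(\hat A,\hat N_1,\dots,\hat N_q,\hat X_0,\hat C)$ are locally optimal (a local minimum) for the bound $$\operatorname{tr}(C P(T) C^\top)-2 \operatorname{tr}(C \tilde P(T) \hat C^\top)+\operatorname{tr}(\hat C \hat P(T) \hat C^\top),$$ equivalently for $\mathcal E(\hat A,\hat N_i,\hat X_0,\hat C)=\operatorname{tr}(\hat C\hat P(T)\hat C^\top)-2\operatorname{tr}(C\tilde P(T)\hat C^\top)$, regarded as a function of the reduced coefficients. Then $$\begin{aligned} (a)\quad&\hat C \hat P(T) = C \tilde P(T),\qquad (b)\quad \hat Q(T)\hat X_0 = \tilde Q(T)^\top X_0,\\ (c)\quad & \int_0^T \hat Q(T-t)\hat F(t)\, dt =\int_0^T \tilde Q(T-t)^\top \tilde F(t)\, dt, \\ (d)\quad& \int_0^T \hat Q(T-t) \Big(\sum_{j=1}^{q}\hat N_j k_{ij} \Big) \hat F(t)\, dt = \int_0^T \tilde Q(T-t)^\top \Big(\sum_{j=1}^{q} N_j k_{ij}\Big) \tilde F(t)\, dt \end{aligned}$$ for $i=1,\dots,q$.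
   Context: Setting. $M=(M_1,\dots,M_q)^\top$ is an $\mathbb R^q$-valued square integrable mean-zero Lévy process with covariance matrix $K_M=(k_{ij})$, i.e. $\mathbb E[M(t)M(t)^\top]=K_Mt$ (so $K_M$ is symmetric positive semidefinite). It is defined on a filtered probability space $(\Omega,\mathcal F,(\mathcal F_t)_{t\in[0,T]},\mathbb P)$ with right-continuous and complete filtration, is adapted, and has increments $M(t+h)-M(t)$ independent of $\mathcal F_t$. The original system is $dx(t)=Ax(t)dt+\sum_{i=1}^qN_ix(t-)dM_i(t)$, $x(0)=X_0z_0$, $y(t)=Cx(t)$; the reduced system is $d\hat x(t)=\hat A\hat x(t)dt+\sum_{i=1}^q\hat N_i\hat x(t-)dM_i(t)$, $\hat x(0)=\hat X_0z_0$, $\hat y(t)=\hat C\hat x(t)$, $t\in[0,T]$, with $z_0\in\mathbb R^m$. Operators: $\mathcal L(X)=AX+XA^\top+\sum_{i,j=1}^qN_iXN_j^\top k_{ij}$ on $\mathbb R^{n\times n}$; $\hat{\mathcal L}(X)=\hat AX+X\hat A^\top+\sum_{i,j=1}^q\hat N_iX\hat N_j^\top k_{ij}$ on $\mathbb R^{\hat n\times\hat n}$; $\tilde{\mathcal L}(X)=AX+X\hat A^\top+\sum_{i,j=1}^qN_iX\hat N_j^\top k_{ij}$ on $\mathbb R^{n\times\hat n}$. Their adjoints with respect to the Frobenius inner product are denoted by a star, e.g. $\hat{\mathcal L}^*(X)=\hat A^\top X+X\hat A+\sum_{i,j}\hat N_i^\top X\hat N_jk_{ij}$ and $\tilde{\mathcal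 L}^*(X)=A^\top X+X\hat A+\sum_{i,j}N_i^\top X\hat N_jk_{ij}$. Throughout, $\mathcal L$ and $\hat{\mathcal L}$ are assumed invertible. Covariance functions. Let $\Phi$ be the fundamental solution of the original state equation ($\Phi(t)=I+\int_0^tA\Phi(s)ds+\sum_i\int_0^tN_i\Phi(s-)dM_i(s)$), $\hat\Phi$ that of the reduced one, and $\Phi_d,\hat\Phi_d$ the fundamental solutions of the dual equations, in which $A,N_i$ (resp. $\hat A,\hat N_i$) are replaced by their transposes. Then $F(t)=\mathbb E[\Phi(t)X_0X_0^\top\Phi(t)^\top]$, $\hat F(t)=\mathbb E[\hat\Phi(t)\hat X_0\hat X_0^\top\hat\Phi(t)^\top]$, $\tilde F(t)=\mathbb E[\Phi(t)X_0\hat X_0^\top\hat\Phi(t)^\top]$, $\hat G(t)=\mathbb E[\hat\Phi_d(t)\hat C^\top\hat C\hat\Phi_d(t)^\top]$, $\tilde G(t)=\mathbb E[\Phi_d(t)C^\top\hat C\hat\Phi_d(t)^\top]$; equivalently they are the solutions of $\dot F=\mathcal L[F]$, $F(0)=X_0X_0^\top$; $\dot{\hat F}=\hat{\mathcal L}[\hat F]$, $\hat F(0)=\hat X_0\hat X_0^\top$; $\dot{\tilde F}=\tilde{\mathcal L}[\tilde F]$, $\tilde F(0)=X_0\hat X_0^\top$; $\dot{\hat G}=\hat{\mathcal L}^*[\hat G]$, $\hat G(0)=\hat C^\top\hat C$; $\dot{\tilde G}=\tilde{\mathcal L}^*[\tilde G]$, $\tilde G(0)=C^\top\hat C$. For $s\ge0$: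 $P(s)=\int_0^sF(t)dt$, $\hat P(s)=\int_0^s\hat F(t)dt$, $\tilde P(s)=\int_0^s\tilde F(t)dt$, $\hat Q(s)=\int_0^s\hat G(t)dt$, $\tilde Q(s)=\int_0^s\tilde G(t)dt$. *)

(* Defs.v *)
From HB Require Import structures.
From mathcomp Require Import all_boot all_order all_algebra.
From mathcomp Require Import all_classical all_reals all_analysis.
Set Implicit Arguments.
Unset Strict Implicit.
Unset Printing Implicit Defensive.
Import Order.TTheory GRing.Theory Num.Theory.
Import numFieldNormedType.Exports.
Local Open Scope classical_set_scope.
Local Open Scope ring_scope.

(* The covariance matrix (per unit time) of the driving process enters only
   through [K], with k_ij = [K i j]. *)
Definition is_covariance (R : realType) (q : nat) (K : 'M[R]_q) : Prop :=
  K^T = K /\ forall v : 'rV[R]_q, 0 <= (v *m K *m v^T) 0 0.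

(* With (B, M) = (A, N) this is the generalized Lyapunov operator L of the
   system (A, N); with (B, M) the reduced coefficients it is the mixed
   operator L-tilde. *)
Definition lyap (R : realType) (n k q : nat) (K : 'M[R]_q)
    (A : 'M[R]_n) (N : 'I_q -> 'M[R]_n) (B : 'M[R]_k) (M : 'I_q -> 'M[R]_k)
    (X : 'M[R]_(n, k)) : 'M[R]_(n, k) :=
  A *m X + X *m B^T
  + \sum_(i < q) \sum_(j < q) K i j *: (N i *m X *m (M j)^T).

Definition lyap_adj (R : realType) (n k q : nat) (K : 'M[R]_q)
    (A : 'M[R]_n) (N : 'I_q -> 'M[R]_n) (B : 'M[R]_k) (M : 'I_q -> 'M[R]_k)
    (X : 'M[R]_(n, k)) : 'M[R]_(n, k) :=
  A^T *m X + X *m B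
  + \sum_(i < q) \sum_(j < q) K i j *: ((N i)^T *m X *m M j).

(* [lyap_adj] is the adjoint of [lyap] for the Frobenius inner product. *)
Lemma lyap_adjP (R : realType) (n k q : nat) (K : 'M[R]_q)
    (A : 'M[R]_n) (N : 'I_q -> 'M[R]_n) (B : 'M[R]_k) (M : 'I_q -> 'M[R]_k)
    (X Y : 'M[R]_(n, k)) :
  \tr (lyap K A N B M X *m Y^T) = \tr (X *m (lyap_adj K A N B M Y)^T).
Proof.
have trD (U V : 'M[R]_(n, k)) : (U + V)^T = U^T + V^T by exact: linearD.
have trZ a (U : 'M[R]_(n, k)) : (a *: U)^T = a *: U^T by exact: linearZ.
have tr_sum (U : 'I_q -> 'M[R]_(n, k)) : (\sum_i U i)^T = \sum_i (U i)^T.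
  exact: linear_sum.
rewrite /lyap /lyap_adj !mulmxDl !mxtraceD !trD !mulmxDr !mxtraceD.
congr (_ + _ + _).
- by rewrite trmx_mul trmxK mulmxA [RHS]mxtrace_mulC mulmxA.
- by rewrite trmx_mul mulmxA.
rewrite tr_sum mulmx_suml mulmx_sumr !raddf_sum; apply: eq_bigr => i _ /=.
rewrite tr_sum mulmx_suml mulmx_sumr !raddf_sum; apply: eq_bigr => j _ /=.
rewrite trZ -scalemxAl -scalemxAr !mxtraceZ; congr (_ * _).
by rewrite !trmx_mul trmxK !mulmxA [RHS]mxtrace_mulC !mulmxA.
Qed.

Definition ivp_sol (R : realType) (n k : nat)
    (L : 'M[R]_(n, k) -> 'M[R]_(n, k)) (X : 'M[R]_(n, k))
    (F : R -> 'M[R]_(n, k)) : Prop :=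
  [/\ F 0 = X,
      {within `[0, +oo[, continuous F} &
      forall t : R, 0 < t -> is_derive t 1 F (L (F t))].

(* The solution of F' = L(F), F(0) = X. It is used only for t >= 0, where it is
   unique for linear L; [ivp] is unspecified at negative times. *)
Definition ivp (R : realType) (n k : nat)
    (L : 'M[R]_(n, k) -> 'M[R]_(n, k)) (X : 'M[R]_(n, k)) :
    R -> 'M[R]_(n, k) :=
  get [set F | ivp_sol L X F].

Definition mxint (R : realType) (n k : nat) (a b : R)
    (F : R -> 'M[R]_(n, k)) : 'M[R]_(n, k) :=
  \matrix_(i, j) \int[lebesgue_measure]_(t in `[a, b]) F t i j.

(* E[Phi(t) X Y^T Psi(t)^T] for the fundamental solutions Phi of (A, N) and Psi
   of (B, M), as the solution of its matrix differential equation: this gives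
   F, F-hat and F-tilde. *)
Definition covF (R : realType) (n k m q : nat) (K : 'M[R]_q)
    (A : 'M[R]_n) (N : 'I_q -> 'M[R]_n) (X : 'M[R]_(n, m))
    (B : 'M[R]_k) (M : 'I_q -> 'M[R]_k) (Y : 'M[R]_(k, m)) :
    R -> 'M[R]_(n, k) :=
  ivp (lyap K A N B M) (X *m Y^T).

(* The same for the dual equations, with initial value C^T D: this gives G-hat
   and G-tilde. *)
Definition covG (R : realType) (n k p q : nat) (K : 'M[R]_q)
    (A : 'M[R]_n) (N : 'I_q -> 'M[R]_n) (C : 'M[R]_(p, n))
    (B : 'M[R]_k) (M : 'I_q -> 'M[R]_k) (D : 'M[R]_(p, k)) :
    R -> 'M[R]_(n, k) :=
  ivp (lyap_adj K A N B M) (C^T *m D).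

Definition gramP (R : realType) (n k m q : nat) (K : 'M[R]_q)
    (A : 'M[R]_n) (N : 'I_q -> 'M[R]_n) (X : 'M[R]_(n, m))
    (B : 'M[R]_k) (M : 'I_q -> 'M[R]_k) (Y : 'M[R]_(k, m))
    (s : R) : 'M[R]_(n, k) :=
  mxint 0 s (covF K A N X B M Y).

Definition gramQ (R : realType) (n k p q : nat) (K : 'M[R]_q)
    (A : 'M[R]_n) (N : 'I_q -> 'M[R]_n) (C : 'M[R]_(p, n))
    (B : 'M[R]_k) (M : 'I_q -> 'M[R]_k) (D : 'M[R]_(p, k))
    (s : R) : 'M[R]_(n, k) :=
  mxint 0 s (covG K A N C B M D).

Definition error_bound (R : realType) (n k m p q : nat) (K : 'M[R]_q) (T : R)
    (A : 'M[R]_n) (N : 'I_q -> 'M[R]_n) (X : 'M[R]_(n, m)) (C : 'M[R]_(p, n))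
    (B : 'M[R]_k) (M : 'I_q -> 'M[R]_k) (Y : 'M[R]_(k, m)) (D : 'M[R]_(p, k)) :
    R :=
  \tr (C *m gramP K A N X A N X T *m C^T)
  - 2 * \tr (C *m gramP K A N X B M Y T *m D^T)
  + \tr (D *m gramP K B M Y B M Y T *m D^T).

(* Local minimality with respect to all reduced coefficients jointly; the norm
   on matrices is the maximum norm. *)
Definition locally_optimal (R : realType) (n k m p q : nat) (K : 'M[R]_q)
    (T : R)
    (A : 'M[R]_n) (N : 'I_q -> 'M[R]_n) (X : 'M[R]_(n, m)) (C : 'M[R]_(p, n))
    (B : 'M[R]_k) (M : 'I_q -> 'M[R]_k) (Y : 'M[R]_(k, m)) (D : 'M[R]_(p, k)) :
    Prop :=
  exists2 e : R, 0 < e &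
    forall (B' : 'M[R]_k) (M' : 'I_q -> 'M[R]_k)
           (Y' : 'M[R]_(k, m)) (D' : 'M[R]_(p, k)),
      `|B' - B| < e -> (forall i, `|M' i - M i| < e) ->
      `|Y' - Y| < e -> `|D' - D| < e ->
      error_bound K T A N X C B M Y D <= error_bound K T A N X C B' M' Y' D'.

(* Main.v *)
From HB Require Import structures.
Require Import Defs.
From mathcomp Require Import all_boot all_order all_algebra.
From mathcomp Require Import all_classical all_reals all_analysis.
From mathcomp Require Import ring lra.
Import Order.TTheory GRing.Theory Num.Theory.
Import numFieldNormedType.Exports.
Local Open Scope classical_set_scope.
Local Open Scope ring_scope.
Set Implicit Arguments.
Unset Strict Implicit.
Unset Printing Implicit Defensive.

(** Each integrated covariance function [P] solves an affine equation
    [dP/dt = L P + X], [P 0 = 0], on the whole line, where [L] is one of the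
    generalized Lyapunov operators; the covariance function itself is then
    [F = L P + X]. Likewise [dQ/dt = L* Q + W], [Q 0 = 0], for the dual objects.
    Solutions are given by the exponential series, and an energy estimate makes
    them unique, so that the integrals in the theorem become values of these
    smooth functions ([ivpE], [mxint_ivp]).

    The dependence of a term [<W, P T>] of the cost on the coefficients is read
    off from duality. Let [P'] belong to a perturbed operator [L'], and let
    [F' = L' P' + X]. Then [<Q (T - t), F' t> + <W, P' t>] has the derivative
    [<Q (T - t), (L' - L) (F' t)>] in [t], whence ([perturbed_duality])
    [[
      <W, P' T> = <Q T, X> + int_0^T <Q (T - t), (L' - L) (F' t)> dt.
    ]]
    This formula is exact. For [L' = L + e L1 + e^2 L2] the energy estimate gives
    [F' - F = O(e)] uniformly between [0] and [T], so the derivative of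
    [<W, P' T>] at [e = 0] is [int_0^T <Q (T - t), L1 (F t)> dt], with an error
    of order [e^2] ([first_order_expansion]).

    At a local minimum the first order term vanishes along every line
    ([linear_coef_eq0]). The cost is [<Ch^T Ch, Ph T> - 2 <C^T Ch, Pt T>].
    Moving [Ch] alone is a quadratic problem ([optimal_output]). Moving [Xh0]
    alone becomes one when [<W, P T>] is rewritten as [<Q T, X>]
    ([optimal_initial_state]). Moving [Ah] and the [Nh i] uses the expansion.
    There the operator of the reduced system varies on both sides, but [Fh] and
    [Qh] are symmetric, so that its two first order terms contribute equally,
    and their sum matches the factor [2] in front of the mixed term
    ([optimal_dynamics]). Directions supported on a single matrix entry turn
    this into the two integral identities, entry by entry. *)

(** * Frobenius inner product and bounds for linear operators *)

Section Frobenius.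
Context {R : realType}.
Implicit Types n k : nat.

Definition frob n k (X Y : 'M[R]_(n, k)) : R := \sum_i \sum_j X i j * Y i j.

Lemma frobE n k (X Y : 'M[R]_(n, k)) : frob X Y = \tr (X *m Y^T).
Proof.
rewrite /frob /mxtrace; apply: eq_bigr => i _; rewrite mxE.
by apply: eq_bigr => j _; rewrite mxE.
Qed.

Lemma frobC n k (X Y : 'M[R]_(n, k)) : frob X Y = frob Y X.
Proof. by apply: eq_bigr => i _; apply: eq_bigr => j _; rewrite mulrC. Qed.

Lemma frobT n k (X Y : 'M[R]_(n, k)) : frob X^T Y^T = frob X Y.
Proof.
rewrite /frob exchange_big; apply: eq_bigr => i _; apply: eq_bigr => j _.
by rewrite !mxE.
Qed.

Lemma frobDl n k (X Y Z : 'M[R]_(n, k)) : frob (X + Y) Z = frob X Z + frob Y Z.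
Proof. by rewrite !frobE mulmxDl mxtraceD. Qed.

Lemma frobDr n k (X Y Z : 'M[R]_(n, k)) : frob Z (X + Y) = frob Z X + frob Z Y.
Proof. by rewrite frobC frobDl !(frobC Z). Qed.

Lemma frobZl n k a (X Y : 'M[R]_(n, k)) : frob (a *: X) Y = a * frob X Y.
Proof. by rewrite !frobE -scalemxAl mxtraceZ. Qed.

Lemma frobZr n k a (X Y : 'M[R]_(n, k)) : frob X (a *: Y) = a * frob X Y.
Proof. by rewrite frobC frobZl frobC. Qed.

Lemma frob_sqrZ n k a (X : 'M[R]_(n, k)) :
  frob (a *: X) (a *: X) = a ^+ 2 * frob X X.
Proof. by rewrite frobZl frobZr mulrA. Qed.

Lemma frobNl n k (X Y : 'M[R]_(n, k)) : frob (- X) Y = - frob X Y.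
Proof. by rewrite -scaleN1r frobZl mulN1r. Qed.

Lemma frobNr n k (X Y : 'M[R]_(n, k)) : frob X (- Y) = - frob X Y.
Proof. by rewrite frobC frobNl frobC. Qed.

Lemma frob0l n k (X : 'M[R]_(n, k)) : frob 0 X = 0.
Proof. by rewrite frobE mul0mx mxtrace0. Qed.

Lemma frob0r n k (X : 'M[R]_(n, k)) : frob X 0 = 0.
Proof. by rewrite frobC frob0l. Qed.

Lemma frob_suml n k (I : finType) (X : I -> 'M[R]_(n, k)) Y :
  frob (\sum_i X i) Y = \sum_i frob (X i) Y.
Proof. by rewrite frobE mulmx_suml raddf_sum; apply: eq_bigr => i _; rewrite frobE. Qed.

Lemma frob_delta n k (X : 'M[R]_(n, k)) i j : frob X (delta_mx i j) = X i j.
Proof.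
rewrite /frob (bigD1 i)//= (bigD1 j)//= !mxE !eqxx mulr1.
rewrite [X in _ + X + _]big1 => [|j' /negPf nj]; last first.
  by rewrite mxE nj andbF mulr0.
rewrite [X in _ + _ + X]big1 => [|i' /negPf ni]; first by rewrite !addr0.
by rewrite big1 // => j' _; rewrite mxE ni mulr0.
Qed.

Lemma frob_ge0 n k (X : 'M[R]_(n, k)) : 0 <= frob X X.
Proof. by apply: sumr_ge0 => i _; apply: sumr_ge0 => j _; rewrite -expr2 sqr_ge0. Qed.

Lemma sqr_entry_le_frob n k (X : 'M[R]_(n, k)) i j : X i j ^+ 2 <= frob X X.
Proof.
rewrite /frob (bigD1 i)//= (bigD1 j)//= -expr2 -addrA lerDl addr_ge0//.
  by apply: sumr_ge0 => *; rewrite -expr2 sqr_ge0.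
by apply: sumr_ge0 => *; apply: sumr_ge0 => *; rewrite -expr2 sqr_ge0.
Qed.

Lemma frob_eq0 n k (X : 'M[R]_(n, k)) : frob X X <= 0 -> X = 0.
Proof.
move=> X0; apply/matrixP => i j; rewrite [RHS]mxE; apply/eqP.
by rewrite -sqrf_eq0 eq_le sqr_ge0 (le_trans (sqr_entry_le_frob X i j)).
Qed.

Lemma frob_sqrD_le n k (X Y : 'M[R]_(n, k)) :
  frob (X + Y) (X + Y) <= 2 * frob X X + 2 * frob Y Y.
Proof.
have := frob_ge0 (X - Y); rewrite !frobDl !frobDr !frobNl !frobNr.
rewrite (frobC Y X); lra.
Qed.

(** The estimates below use this inequality in place of Cauchy-Schwarz: only
    squared norms occur, and no square roots. *)
Lemma frob_AMGM n k (X Y : 'M[R]_(n, k)) :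
  2 * `|frob X Y| <= frob X X + frob Y Y.
Proof.
have := frob_ge0 (X - Y); have := frob_ge0 (X + Y).
rewrite !frobDl !frobDr !frobNl !frobNr (frobC Y X).
by case: ler0P => _; lra.
Qed.

(** Image of the unit matrix [delta_mx i j] under the adjoint of [L]. Pairing
    with it expresses an entry of [L X] as an inner product, so that facts about
    [frob] transfer to linear operators. *)
Definition lin_coef n k (L : 'M[R]_(n, k) -> 'M[R]_(n, k)) i j : 'M[R]_(n, k) :=
  \matrix_(a, b) L (delta_mx a b) i j.

Lemma lin_coefE n k (L : {linear 'M[R]_(n, k) -> 'M[R]_(n, k)}) X i j :
  L X i j = frob X (lin_coef L i j).
Proof.
rewrite {1}[X]matrix_sum_delta linear_sum summxE; apply: eq_bigr => a _.
rewrite linear_sum summxE; apply: eq_bigr => b _.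
by rewrite linearZ !mxE.
Qed.

Lemma frob_lin_bounded n k (L : {linear 'M[R]_(n, k) -> 'M[R]_(n, k)}) :
  exists2 c, 0 <= c & forall X, frob (L X) (L X) <= c * frob X X.
Proof.
have bsum (I : finType) (f : I -> 'M[R]_(n, k) -> 'M[R]_(n, k)) :
    (forall i, exists2 c, 0 <= c & forall X, frob (f i X) (f i X) <= c * frob X X) ->
    exists2 c, 0 <= c & forall X,
      frob (\sum_i f i X) (\sum_i f i X) <= c * frob X X.
  move=> fb; rewrite /index_enum; elim: (Finite.enum I) => [|i s [c c0 IH]].
    by exists 0 => // X; rewrite big_nil frob0l mul0r.
  have [d d0 di] := fb i; exists (2 * d + 2 * c) => [|X]; first lra.
  rewrite big_cons; apply: le_trans (frob_sqrD_le _ _) _.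
  by have := di X; have := IH X; lra.
have [|c c0 cL] := bsum _ (fun i X => \sum_j X i j *: L (delta_mx i j)).
  move=> i; apply: bsum => j.
  exists (frob (L (delta_mx i j)) (L (delta_mx i j))) => [|X].
    exact: frob_ge0.
  rewrite frob_sqrZ mulrC ler_wpM2l ?frob_ge0//.
  exact: sqr_entry_le_frob.
exists c => // X; suff -> : L X = \sum_i \sum_j X i j *: L (delta_mx i j) by [].
rewrite {1}[X]matrix_sum_delta linear_sum; apply: eq_bigr => a _.
by rewrite linear_sum; apply: eq_bigr => b _; rewrite linearZ.
Qed.

Lemma frob_lin3_bounded n k (L L1 L2 : {linear 'M[R]_(n, k) -> 'M[R]_(n, k)}) :
  exists2 c, 0 <= c & forall X, [/\ frob (L X) (L X) <= c * frob X X,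
    frob (L1 X) (L1 X) <= c * frob X X & frob (L2 X) (L2 X) <= c * frob X X].
Proof.
have [a a0 aP] := frob_lin_bounded L; have [b b0 bP] := frob_lin_bounded L1.
have [c c0 cP] := frob_lin_bounded L2.
exists (a + b + c) => [|X]; first by rewrite !addr_ge0.
have X0 := frob_ge0 X; have := mulr_ge0 a0 X0; have := mulr_ge0 b0 X0.
have := mulr_ge0 c0 X0; have := aP X; have := bP X; have := cP X.
by split; lra.
Qed.

End Frobenius.

(** * Differential calculus along matrix-valued paths *)

Section MatrixCalculus.
Context {R : realType}.
Implicit Types n k : nat.

Lemma is_derive_mxP n k (F : R -> 'M[R]_(n, k)) (D : 'M[R]_(n, k)) (t : R) :
  is_derive t 1 F D <-> forall i j, is_derive t 1 (fun s => F s i j) (D i j).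
Proof.
split=> [[dF <-] i j|dF].
  apply: DeriveDef; first by move/derivable_mxP : dF; exact.
  by rewrite derive_mx// mxE.
have F1 : derivable F t 1 by apply/derivable_mxP => i j; case: (dF i j).
apply: DeriveDef => //; rewrite derive_mx//; apply/matrixP => i j.
by rewrite mxE; case: (dF i j).
Qed.

Lemma is_derive_sumf (I : finType) (h : I -> R -> R) (dh : I -> R) (t : R) :
  (forall i, is_derive t 1 (h i) (dh i)) ->
  is_derive t 1 (fun s => \sum_i h i s) (\sum_i dh i).
Proof.
move=> H; have -> : (fun s => \sum_i h i s) = \sum_i h i.
  by apply/funext => s; rewrite fct_sumE.
by elim/big_ind2 : _ => // [|] *; [exact: is_derive_cst|exact: is_deriveD].
Qed.

Lemma is_derive_frob n k (U V : R -> 'M[R]_(n, k)) u v (t : R) :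
  is_derive t 1 U u -> is_derive t 1 V v ->
  is_derive t 1 (fun s => frob (U s) (V s)) (frob u (V t) + frob (U t) v).
Proof.
move=> /is_derive_mxP dU /is_derive_mxP dV.
have -> : frob u (V t) + frob (U t) v =
    \sum_i \sum_j (U t i j * v i j + V t i j * u i j).
  rewrite /frob -big_split; apply: eq_bigr => i _ /=.
  by rewrite -big_split; apply: eq_bigr => j _ /=; ring.
apply: is_derive_sumf => i; apply: is_derive_sumf => j.
exact: is_deriveM (dU i j) (dV i j).
Qed.

Lemma is_derive_lin n k (L : {linear 'M[R]_(n, k) -> 'M[R]_(n, k)})
    (U : R -> 'M[R]_(n, k)) u W (t : R) :
  is_derive t 1 U u -> is_derive t 1 (fun s => L (U s) + W) (L u).
Proof.
move=> dU; apply/is_derive_mxP => i j.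
have -> : (fun s => (L (U s) + W) i j) =
    (fun s => frob (U s) (lin_coef L i j)) + cst (W i j).
  by apply/funext => s; rewrite mxE lin_coefE.
have dcst : is_derive t 1 (fun=> lin_coef L i j : 'M[R]_(n, k)) 0.
  exact: is_derive_cst.
have := is_deriveD (is_derive_frob dU dcst) (is_derive_cst (W i j) t 1).
by rewrite frob0r !addr0 -lin_coefE.
Qed.

Lemma is_derive_rev n k (U : R -> 'M[R]_(n, k)) u (T t : R) :
  is_derive (T - t) 1 U u -> is_derive t 1 (fun s => U (T - s)) (- u).
Proof.
move=> /is_derive_mxP dU; apply/is_derive_mxP => i j.
have dr : is_derive t 1 (fun s : R => T - s) (-1).
  have := is_deriveB (is_derive_cst T t 1) (is_derive_id t 1).
  by rewrite sub0r.
have := @is_derive1_comp _ (fun s => U s i j) (fun s => T - s) t _ _ (dU i j) dr.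
by rewrite mxE mulrN1.
Qed.

Lemma derive_continuous (f df : R -> R) :
  (forall t : R, is_derive t 1 f (df t)) -> continuous f.
Proof.
move=> dF t; apply/differentiable_continuous/derivable1_diffP.
by case: (dF t).
Qed.

Lemma continuous_frob n k : continuous (fun Z : 'M[R]_(n, k) => frob Z Z).
Proof.
move=> Z; rewrite /frob.
have -> : (fun Z : 'M[R]_(n, k) => \sum_i \sum_j Z i j * Z i j) =
    \sum_i \sum_j (fun Z : 'M[R]_(n, k) => Z i j * Z i j).
  apply/funext => X; rewrite fct_sumE; apply: eq_bigr => i _.
  by rewrite fct_sumE.
apply: (big_ind (fun f => {for Z, continuous f})).
- exact: cst_continuous.
- by move=> *; exact: continuousD.
move=> i _; apply: (big_ind (fun f => {for Z, continuous f})).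
- exact: cst_continuous.
- by move=> *; exact: continuousD.
by move=> j _; apply: continuousM; exact: coord_continuous.
Qed.

(** The function [expR (- a * s) * f s - b * s] is nonincreasing. Only interior
    differentiability is assumed, as this is what an [ivp_sol] provides. *)
Lemma gronwall (T a b : R) (f df : R -> R) : 0 <= a -> 0 <= b -> f 0 = 0 ->
  {within `[0, T], continuous f} ->
  (forall t : R, t \in `]0, T[%R -> is_derive t 1 f (df t)) ->
  (forall t : R, t \in `]0, T[%R -> df t <= a * f t + b) ->
  forall t, t \in `[0, T]%R -> f t <= b * t * expR (a * t).
Proof.
move=> a0 b0 f0 cf df_ dfle t tT.
pose g s := expR (- a * s) * f s - b * s.
have dE (s : R) : is_derive s 1 (fun s => expR (- a * s)) (- a * expR (- a * s)).
  have dl : is_derive s 1 (fun s : R => - a * s) (- a).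
    have := is_deriveZ (- a) (is_derive_id s 1).
    by rewrite [_ *: 1]mulr1.
  have := @is_derive1_comp _ _ _ s _ _ (is_derive_expR (- a * s)) dl.
  by rewrite mulrC.
have dl (s : R) : is_derive s 1 (fun s : R => b * s) b.
  have := is_deriveZ b (is_derive_id s 1).
  by rewrite [_ *: 1]mulr1.
have dg s : s \in `]0, T[%R -> is_derive s 1 g
   (expR (- a * s) * df s + f s * (- a * expR (- a * s)) - b).
  move=> sT; exact: is_deriveB (is_deriveM (dE s) (df_ s sT)) (dl s).
have := @ler0_derive1_le_cc _ g 0 T _ _ _ t 0 tT.
have -> : g 0 = 0 by rewrite /g f0 !mulr0 subr0.
rewrite /g => H; have {}H : expR (- a * t) * f t - b * t <= 0.
  move: (tT); rewrite in_itv/= => /andP[t0 tT'].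
  apply: H => //.
  - by move=> s sT; case: (dg s sT).
  - move=> s sT; rewrite derive1E; have [_ ->] := dg s sT.
    have e0 := expR_gt0 (- a * s).
    have e1 : expR (- a * s) <= 1.
      rewrite -[leRHS]expR0 ler_expR mulNr oppr_le0 mulr_ge0//.
      by move: sT; rewrite in_itv/= => /andP[/ltW].
    have := dfle s sT; rewrite -(ler_pM2l e0) => H.
    have := ler_wpM2r b0 e1; lra.
  - move=> s; apply: cvgB.
      apply: cvgM; last exact: cf.
      by apply: continuous_subspaceT => x; exact: derive_continuous dE x.
    by apply: continuous_subspaceT => x; exact: derive_continuous dl x.
  - by rewrite in_itv/= lexx (le_trans t0).
rewrite -(ler_pM2l (expR_gt0 (- a * t))) mulrCA -expRD -mulrDl addNr mul0r.
by rewrite expR0; lra.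
Qed.

(** Gronwall's inequality for the energy [frob (D t) (D t)], whose derivative
    [2 * frob (D t) (dD t)] is at most the sum of the two squared norms; this is
    where the [1] in the exponent comes from. The case [b = 0] gives uniqueness
    for linear equations, and [b] of order [e ^+ 2] gives their Lipschitz
    dependence on a parameter [e]. *)
Lemma energy_estimate n k (T a b : R) (D dD : R -> 'M[R]_(n, k)) :
  0 <= a -> 0 <= b -> D 0 = 0 ->
  {within `[0, T], continuous D} ->
  (forall t : R, t \in `]0, T[%R -> is_derive t 1 D (dD t)) ->
  (forall t : R, t \in `]0, T[%R ->
    frob (dD t) (dD t) <= a * frob (D t) (D t) + b) ->
  forall t, t \in `[0, T]%R ->
    frob (D t) (D t) <= b * t * expR ((a + 1) * t).
Proof.
move=> a0 b0 D0 cD dD_ dDle.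
apply: (@gronwall T (a + 1) b (fun t => frob (D t) (D t))
  (fun t => frob (dD t) (D t) + frob (D t) (dD t))) => //.
- by rewrite addr_ge0.
- by rewrite D0 frob0l.
- move=> t; exact: (cvg_comp _ _ (cD t) (@continuous_frob n k (D t))).
- by move=> t tT; apply: is_derive_frob; exact: dD_.
- move=> t tT; rewrite (frobC (dD t)).
  have := dDle t tT; have := frob_AMGM (D t) (dD t).
  have := ler_norm (frob (D t) (dD t)); lra.
Qed.

End MatrixCalculus.

(** * Affine equations solved by power series *)

Section ExponentialSeries.
Context {R : realType}.
Implicit Types n k : nat.

(** Exponential generating function: differentiation shifts the coefficients. *)
Definition egf (b : nat -> R) (t : R) : R :=
  limn (pseries (fun l => b l / l`!%:R) t).

Lemma is_cvg_egf (b : nat -> R) (M C : R) :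
  (forall l, `|b l| <= M * C ^+ l) ->
  forall t, cvgn (pseries (fun l => b l / l`!%:R) t).
Proof.
move=> bM t; apply: normed_cvg.
have le_exp l : `|b l / l`!%:R * t ^+ l| <= M * exp_coeff (C * `|t|) l.
  rewrite mulrAC normrM [X in _ * X]ger0_norm ?invr_ge0 ?ler0n//.
  rewrite /exp_coeff /= mulrA exprMn mulrA.
  by rewrite ler_wpM2r ?invr_ge0// normrM normrX ler_wpM2r.
apply: (@series_le_cvg _ _ (fun l => M * exp_coeff (C * `|t|) l)).
- by move=> l; exact: normr_ge0.
- by move=> l; apply: (le_trans _ (le_exp l)); exact: normr_ge0.
- exact: le_exp.
have -> : series (fun l => M * exp_coeff (C * `|t|) l) =
    M \*: series (exp_coeff (C * `|t|)).
  by apply/funext => l; rewrite /series/= -mulr_sumr.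
apply: is_cvgZr; exact: is_cvg_series_exp_coeff.
Qed.

Lemma is_derive_egf (b : nat -> R) (M C : R) :
  (forall l, `|b l| <= M * C ^+ l) ->
  forall t : R, is_derive t 1 (egf b) (egf (b \o succn) t).
Proof.
have diffsE (d : nat -> R) : pseries_diffs (fun l => d l / l`!%:R) =
    fun l => (d \o succn) l / l`!%:R.
  apply/funext => l; rewrite /pseries_diffs /= factS natrM invfM mulrCA.
  by rewrite mulVKf ?pnatr_eq0.
have shift (d : nat -> R) (N : R) : (forall l, `|d l| <= N * C ^+ l) ->
    forall l, `|(d \o succn) l| <= (N * C) * C ^+ l.
  by move=> dN l; rewrite /= -mulrA -exprS.
move=> bM t; rewrite /egf -diffsE; apply: (@pseries_snd_diffs _ _ (`|t| + 1)).
- exact: is_cvg_egf bM _.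
- by rewrite diffsE; exact: (is_cvg_egf (shift _ _ bM)).
- by rewrite !diffsE; exact: (is_cvg_egf (shift _ _ (shift _ _ bM))).
- by rewrite [ltRHS]ger0_norm ?addr_ge0// ltrDl.
Qed.

Lemma egf0 (b : nat -> R) : egf b 0 = b 0%N.
Proof.
apply: cvg_lim => //; apply: cvg_near_cst; near=> N.
rewrite /pseries /series /=; have -> : N = N.-1.+1.
  by rewrite prednK//; near: N; exact: nbhs_infty_gt.
rewrite big_nat_recl// big1 => [|i _]; first by rewrite expr0 divr1 mulr1 addr0.
by rewrite expr0n mulr0.
Unshelve. all: by end_near. Qed.

(** Equations on the whole line with zero initial value. The homogeneous problem
    with initial value [W] is contained in this one, as [fun t => L (U t) + W]
    solves it; hence a solution and its primitive are obtained together. *)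
Definition affine_sol n k (L : 'M[R]_(n, k) -> 'M[R]_(n, k)) (W : 'M[R]_(n, k))
    (U : R -> 'M[R]_(n, k)) : Prop :=
  U 0 = 0 /\ forall t : R, is_derive t 1 U (L (U t) + W).

(** The solution is the series of [L^(l-1) W * t^l / l!] over [l >= 1], taken
    entrywise; it converges because [L] is bounded. *)
Lemma affine_sol_exists n k (L : {linear 'M[R]_(n, k) -> 'M[R]_(n, k)})
    (W : 'M[R]_(n, k)) : exists U, affine_sol L W U.
Proof.
pose B l : 'M[R]_(n, k) := if l is l'.+1 then iter l' L W else 0.
have [c c0 cL] := frob_lin_bounded L.
have BW l : frob (B l) (B l) <= (1 + c) ^+ l * frob W W.
  have c1 : 0 <= 1 + c by rewrite addr_ge0.
  case: l => [|l] /=; first by rewrite frob0l expr0 mul1r frob_ge0.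
  elim: l => [|l IH] /=.
    by rewrite expr1 mulrDl mul1r lerDl mulr_ge0// frob_ge0.
  apply: le_trans (cL _) _; apply: (@le_trans _ _ ((1 + c) * frob (iter l L W) (iter l L W))).
    by rewrite ler_wpM2r ?frob_ge0// lerDr.
  by rewrite exprS -mulrA ler_wpM2l.
(* The rate (1 + c) ^+ l of the squares serves for the entries, as 1 <= 1 + c. *)
have Bb i j l : `|B l i j| <= (1 + frob W W) * (1 + c) ^+ l.
  have W0 := frob_ge0 W.
  have c1 : 1 <= (1 + c) ^+ l by rewrite exprn_ege1// lerDl.
  rewrite -ler_sqr ?nnegrE ?mulr_ge0 ?addr_ge0 ?exprn_ge0 ?addr_ge0//.
  rewrite real_normK ?num_real//; apply: le_trans (sqr_entry_le_frob _ i j) _.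
  apply: le_trans (BW l) _; rewrite exprMn mulrC ler_pM ?exprn_ge0 ?addr_ge0//.
    by nra.
  by rewrite expr2 ler_peMr// (le_trans ler01).
pose U t : 'M[R]_(n, k) := \matrix_(i, j) egf (fun l => B l i j) t.
exists U; split.
  by apply/matrixP => i j; rewrite !mxE egf0 mxE.
move=> t; apply/is_derive_mxP => i j.
have -> : (fun s => U s i j) = egf (fun l => B l i j).
  by apply/funext => s; rewrite mxE.
apply: is_derive_eq (is_derive_egf (Bb i j) t) _.
apply: cvg_lim => //.
(* Entrywise [B l.+1 = L (B l)], except that [B 1 = W] while [B 0 = 0]; the
   last summand accounts for this one index. *)
have -> : pseries (fun l => ((fun l => B l i j) \o succn) l / l`!%:R) t =
  (fun N => \sum_a \sum_b
      lin_coef L i j a b * pseries (fun l => B l a b / l`!%:R) t N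
    + (0 < N)%N%:R * W i j).
  apply/funext => N; elim: N => [|N IH].
    rewrite /pseries/= /series/= big_geq// mul0r addr0 big1// => a _.
    by rewrite big1// => b _; rewrite big_geq// mulr0.
  rewrite /pseries /series /= big_nat_recr//=.
  move: IH; rewrite /pseries /series /= => ->.
  under [in RHS]eq_bigr do under eq_bigr do rewrite big_nat_recr//= mulrDr.
  under [in RHS]eq_bigr do rewrite big_split.
  rewrite big_split /= -!addrA; congr (_ + _).
  have -> : iter N L W i j = \sum_a \sum_b lin_coef L i j a b * B N a b
      + (N == 0)%N%:R * W i j.
    case: N => [|N] /=.
      rewrite mul1r big1 ?add0r// => a _.
      by rewrite big1// => b _; rewrite [X in _ * X]mxE mulr0.
    rewrite mul0r addr0 lin_coefE frobC //.
  rewrite mulrDl mulrDl addrCA; congr (_ + _).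
    by rewrite !mulr_suml; apply: eq_bigr => a _; rewrite !mulr_suml;
       apply: eq_bigr => b _; rewrite !mulrA.
  case: N => [|N] /=; first by rewrite mul0r add0r expr0 divr1 mulr1 mul1r.
  by rewrite !mul0r addr0.
rewrite mxE; apply: cvgD; last first.
  apply: cvg_near_cst; near=> N; rewrite (_ : (0 < N)%N) ?mul1r//.
  by near: N; exact: nbhs_infty_gt.
rewrite lin_coefE frobC /frob.
apply: cvg_big => [|a _]; first exact: add_continuous.
apply: cvg_big => [|b _]; first exact: add_continuous.
apply: cvgMl_tmp; rewrite mxE; exact: is_cvg_egf (Bb a b) t.
Unshelve. all: by end_near. Qed.

End ExponentialSeries.

(** * Integrals of continuous functions over segments *)

Section Integration.
Context {R : realType}.
Implicit Types (n k : nat) (f g F : R -> R).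
Local Notation mu := (@lebesgue_measure R).

Lemma continuous_integrable_itv f (a b : R) : continuous f ->
  mu.-integrable `[a, b] (EFin \o f).
Proof.
move=> cf; apply: continuous_compact_integrable; first exact: segment_compact.
exact: continuous_subspaceT.
Qed.

Lemma Rintegral_derive F f (a b : R) : a <= b ->
  (forall t : R, is_derive t 1 F (f t)) -> continuous f ->
  \int[mu]_(t in `[a, b]) f t = F b - F a.
Proof.
rewrite le_eqVlt => /predU1P[<-|ab] dF cf.
  by rewrite set_itv1 Rintegral_set1 subrr.
have cF := derive_continuous dF.
rewrite /Rintegral (@continuous_FTC2 _ f F)//.
- exact: continuous_subspaceT.
- split; first by move=> x _; case: (dF x).
    by apply: cvg_at_right_filter; exact: cF.
  by apply: cvg_at_left_filter; exact: cF.
- by move=> x _; rewrite derive1E; case: (dF x).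
Qed.

Lemma Rintegral_norm_le f (T M : R) : 0 <= T -> continuous f ->
  (forall t, t \in `[0, T]%R -> `|f t| <= M) ->
  `|\int[mu]_(t in `[0, T]) f t| <= M * T.
Proof.
move=> T0 cf fM.
have cn : continuous (fun t => `|f t|).
  by move=> t; apply: cvg_norm; exact: cf.
apply: le_trans (le_normr_Rintegral _ (continuous_integrable_itv _ _ cf)) _ => //.
have -> : M * T = \int[mu]_(t in `[0, T]) M.
  rewrite Rintegral_cst//= lebesgue_measure_itv/= lte_fin.
  by case: ltgtP T0 => // [_|<-] _; rewrite /= ?subr0 ?mulr0.
apply: le_Rintegral => //.
- exact: continuous_integrable_itv cn.
- by apply: continuous_integrable_itv; exact: cst_continuous.
Qed.

Lemma RintegralD_continuous f g (a b : R) : continuous f -> continuous g ->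
  \int[mu]_(t in `[a, b]) (f t + g t) =
  \int[mu]_(t in `[a, b]) f t + \int[mu]_(t in `[a, b]) g t.
Proof. by move=> cf cg; rewrite RintegralD//; exact: continuous_integrable_itv. Qed.

Lemma RintegralZl_continuous f (a b c : R) : continuous f ->
  \int[mu]_(t in `[a, b]) (c * f t) = c * \int[mu]_(t in `[a, b]) f t.
Proof. by move=> cf; rewrite RintegralZl//; exact: continuous_integrable_itv. Qed.

Lemma eq_mxint n k (a b : R) (F G : R -> 'M[R]_(n, k)) :
  (forall t, t \in `[a, b]%R -> F t = G t) -> mxint a b F = mxint a b G.
Proof.
move=> FG; apply/matrixP => i j; rewrite !mxE; apply: eq_Rintegral => t.
by rewrite inE/= => tab; rewrite FG.
Qed.

End Integration.

(** * Duality and first order expansion for linear equations *)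

Section LinearEquation.
Context {R : realType}.
Implicit Types n k : nat.
Local Notation mu := (@lebesgue_measure R).

Lemma is_derive_affine_sol n k (L : {linear 'M[R]_(n, k) -> 'M[R]_(n, k)}) X P :
  affine_sol L X P ->
  forall t : R, is_derive t 1 (fun s => L (P s) + X) (L (L (P t) + X)).
Proof. by move=> [_ dP] t; exact: is_derive_lin. Qed.

Lemma continuous_frob_derivable n k (U V u v : R -> 'M[R]_(n, k)) :
  (forall t : R, is_derive t 1 U (u t)) -> (forall t : R, is_derive t 1 V (v t)) ->
  continuous (fun t => frob (U t) (V t)).
Proof.
by move=> dU dV; apply: derive_continuous => t; exact: is_derive_frob.
Qed.

Lemma is_derive_lin0 n k (L : {linear 'M[R]_(n, k) -> 'M[R]_(n, k)})
    (U : R -> 'M[R]_(n, k)) u (t : R) :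
  is_derive t 1 U u -> is_derive t 1 (fun s => L (U s)) (L u).
Proof.
move=> /(is_derive_lin L 0); under eq_fun do rewrite addr0; exact.
Qed.

Lemma derivable_continuous_mx n k (U u : R -> 'M[R]_(n, k)) :
  (forall t : R, is_derive t 1 U (u t)) -> continuous U.
Proof.
move=> dU t; apply/differentiable_continuous/derivable1_diffP.
by case: (dU t).
Qed.

(** Since an [ivp_sol] is differentiable for positive times only, uniqueness
    comes from [energy_estimate] on a segment, applied to the difference. *)
Lemma ivpE n k (L : {linear 'M[R]_(n, k) -> 'M[R]_(n, k)}) X P t :
  affine_sol L X P -> 0 <= t -> ivp L X t = L (P t) + X.
Proof.
move=> solP t0; have dF := is_derive_affine_sol solP.
pose F s := L (P s) + X.
have solF : ivp_sol L X F.
  split; first by rewrite /F (proj1 solP) linear0 add0r.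
    by apply: continuous_subspaceT; exact: derivable_continuous_mx dF.
  by move=> s _; exact: dF.
have [G0 cG dG] : ivp_sol L X (ivp L X).
  by apply: (@getPex _ [set F | ivp_sol L X F]); exists F.
have [_ cF _] := solF; have [c c0 cL] := frob_lin_bounded L.
have sub : [set` `[0, t]] `<=` [set` `[0, +oo[%R].
  by apply/subset_itvl; rewrite bnd_simp.
pose D s := ivp L X s - F s.
have cD : {within `[0, t], continuous D}.
  move=> s; apply: cvgB.
    exact: (continuous_subspaceW sub cG).
  exact: (continuous_subspaceW sub cF).
have D0 : D 0 = 0 by rewrite /D G0 /F (proj1 solP) linear0 add0r subrr.
have dD s : s \in `]0, t[%R -> is_derive s 1 D (L (D s)).
  rewrite in_itv/= => /andP[s0 _]; rewrite /D linearB.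
  exact: is_deriveB (dG s s0) (dF s).
have := @energy_estimate _ _ _ t c 0 D (L \o D) c0 (lexx 0) D0 cD dD.
move=> /(_ _ t); rewrite in_itv/= t0 lexx !mul0r => H.
apply/eqP; rewrite -subr_eq0; apply/eqP/frob_eq0; apply: H => // s _.
by rewrite addr0; exact: cL.
Qed.

Lemma mxint_ivp n k (L : {linear 'M[R]_(n, k) -> 'M[R]_(n, k)}) X P s :
  affine_sol L X P -> 0 <= s -> mxint 0 s (ivp L X) = P s.
Proof.
move=> solP s0; have [P0 dP] := solP.
rewrite (@eq_mxint _ _ _ _ _ _ (fun t => L (P t) + X)); last first.
  by move=> t; rewrite in_itv/= => /andP[t0 _]; exact: ivpE.
apply/matrixP => i j; rewrite mxE.
have dPij (t : R) : is_derive t 1 (fun t => P t i j) ((L (P t) + X) i j).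
  by have /is_derive_mxP := dP t; exact.
have dFij (t : R) :
    is_derive t 1 (fun t => (L (P t) + X) i j) (L (L (P t) + X) i j).
  by have /is_derive_mxP := is_derive_affine_sol solP t; exact.
rewrite (Rintegral_derive s0 dPij (derive_continuous dFij)).
by rewrite P0 [X in _ - X]mxE subr0.
Qed.

Lemma affine_sol_rev n k (L : 'M[R]_(n, k) -> 'M[R]_(n, k)) W Q (T : R) :
  affine_sol L W Q ->
  forall t : R, is_derive t 1 (fun s => Q (T - s)) (- (L (Q (T - t)) + W)).
Proof. by move=> [_ dQ] t; apply: is_derive_rev. Qed.

(** The integrand is the derivative of [frob (Q (T - t)) (F t) + frob W (P t)]
    with [F = L' P + X]: the terms in [W] cancel, and moving [Ls] to the other
    side leaves the difference of the two operators. The boundary terms at [T]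
    and [0] are [frob W (P T)] and [frob (Q T) X], as [Q] and [P] vanish at [0]. *)
Lemma perturbed_duality n k (L L' : {linear 'M[R]_(n, k) -> 'M[R]_(n, k)})
    (Ls : 'M[R]_(n, k) -> 'M[R]_(n, k)) X W P Q T :
  (forall Y Z, frob (L Y) Z = frob Y (Ls Z)) -> 0 <= T ->
  affine_sol L' X P -> affine_sol Ls W Q ->
  frob W (P T) = frob (Q T) X +
    \int[mu]_(t in `[0, T]) frob (Q (T - t)) (L' (L' (P t) + X) - L (L' (P t) + X)).
Proof.
move=> adj T0 solP solQ; have dQ := affine_sol_rev T solQ.
have dF := is_derive_affine_sol solP.
have [[P0 dP] [Q0 _]] := (solP, solQ).
pose F t := L' (P t) + X.
pose Psi t := frob (Q (T - t)) (F t) + frob W (P t).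
have dPsi (t : R) : is_derive t 1 Psi
    (frob (Q (T - t)) (L' (L' (P t) + X) - L (L' (P t) + X))).
  have dW : is_derive t 1 (fun=> W) (0 : 'M[R]_(n, k)) by exact: is_derive_cst.
  apply: is_derive_eq.
    exact: is_deriveD (is_derive_frob (dQ t) (dF t)) (is_derive_frob dW (dP t)).
  rewrite frob0l add0r -/(F t) frobNl frobDl (frobDr (L' (F t))) frobNr.
  by rewrite (frobC _ (L (F t))) adj (frobC (F t)); ring.
have cPsi : continuous
    (fun t => frob (Q (T - t)) (L' (L' (P t) + X) - L (L' (P t) + X))).
  have H (L0 : {linear 'M[R]_(n, k) -> 'M[R]_(n, k)}) :
      continuous (fun t => frob (Q (T - t)) (L0 (L' (P t) + X))).
    by apply: continuous_frob_derivable dQ _ => t; apply: is_derive_lin0 (dF t).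
  under eq_fun do rewrite (frobDr (L' _)) frobNr.
  by move=> t; apply: cvgB; exact: H.
rewrite (Rintegral_derive T0 dPsi cPsi) /Psi /F P0 subr0 subrr Q0 linear0.
by rewrite frob0l frob0r addr0 !add0r addrC subrK.
Qed.

Lemma duality n k (L : {linear 'M[R]_(n, k) -> 'M[R]_(n, k)})
    (Ls : 'M[R]_(n, k) -> 'M[R]_(n, k)) X W P Q T :
  (forall Y Z, frob (L Y) Z = frob Y (Ls Z)) -> 0 <= T ->
  affine_sol L X P -> affine_sol Ls W Q -> frob W (P T) = frob (Q T) X.
Proof.
move=> adj T0 solP solQ; rewrite (perturbed_duality adj T0 solP solQ).
under eq_Rintegral do rewrite subrr frob0r.
by rewrite Rintegral_cst// mul0r addr0.
Qed.

Lemma frob_path_bounded n k (U u : R -> 'M[R]_(n, k)) (T : R) : 0 <= T ->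
  (forall t : R, is_derive t 1 U (u t)) ->
  exists2 M, 0 <= M & forall t, t \in `[0, T]%R -> frob (U t) (U t) <= M.
Proof.
move=> T0 dU; have cU := continuous_frob_derivable dU dU.
have [c _ cP] := @EVT_max R (fun t => frob (U t) (U t)) 0 T T0
  (continuous_subspaceT cU).
by exists (frob (U c) (U c)); first exact: frob_ge0.
Qed.

(** By [perturbed_duality] the error is the integral of the pairing of
    [Q (T - t)] with [e L1 (F' - F) + e^2 L2 F'], where [F = L P + X] and
    [F' = L' P' + X]. This is quadratic in [e] as soon as [D = F' - F] is of order
    [e], which [energy_estimate] gives: [D] vanishes at [0], and its derivative
    is [L D + e (L1 F' + e L2 F')]. *)
Lemma first_order_expansion n k (L L1 L2 : {linear 'M[R]_(n, k) -> 'M[R]_(n, k)})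
    (Ls : 'M[R]_(n, k) -> 'M[R]_(n, k)) X W P Q T :
  (forall Y Z, frob (L Y) Z = frob Y (Ls Z)) -> 0 <= T ->
  affine_sol L X P -> affine_sol Ls W Q ->
  exists c, forall e, `|e| <= 1 ->
    forall (L' : {linear 'M[R]_(n, k) -> 'M[R]_(n, k)}) P',
    (forall Z, L' Z = L Z + e *: L1 Z + e ^+ 2 *: L2 Z) ->
    affine_sol L' X P' ->
    `|frob W (P' T) - frob W (P T) -
      e * \int[mu]_(t in `[0, T]) frob (Q (T - t)) (L1 (L (P t) + X))|
    <= c * e ^+ 2.
Proof.
move=> adj T0 solP solQ; have dQ := affine_sol_rev T solQ.
have dF := is_derive_affine_sol solP.
have [c c0 cL] := frob_lin3_bounded L L1 L2.
have [q q0 qQ] := frob_path_bounded T0 dQ.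
have [f f0 fF] := frob_path_bounded T0 dF.
(* Bound on the energy of F' - F, up to the factor e ^+ 2. *)
pose kap := 16 * c * f * T * expR ((18 * c + 1) * T).
have kap0 : 0 <= kap by rewrite !mulr_ge0// expR_ge0.
exists ((q + 2 * c * kap + c * f) * T) => e e1 L' P' L'E solP'.
have e2 : e ^+ 2 <= 1 by rewrite -real_normK ?num_real// expr_le1.
have e20 : 0 <= e ^+ 2 := sqr_ge0 e.
have dF' := is_derive_affine_sol solP'.
pose F t := L (P t) + X; pose F' t := L' (P' t) + X.
pose D t := F' t - F t.
have F'E t : F' t = D t + F t by rewrite /D subrK.
have D0 : D 0 = 0.
  by rewrite /D /F' /F (proj1 solP) (proj1 solP') !linear0 subrr.
have dD (t : R) : is_derive t 1 D (L (D t) + e *: (L1 (F' t) + e *: L2 (F' t))).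
  have dB : is_derive t 1 D (L' (F' t) - L (F t)).
    exact: is_deriveB (dF' t) (dF t).
  apply: is_derive_eq dB _.
  rewrite L'E /D linearB /= scalerDr scalerA -expr2.
  by rewrite -!addrA; congr (_ + _); rewrite addrA [RHS]addrC.
have NF' t : t \in `[0, T]%R -> frob (F' t) (F' t) <= 2 * frob (D t) (D t) + 2 * f.
  move=> tT; rewrite F'E; apply: le_trans (frob_sqrD_le _ _) _.
  by have := fF t tT; rewrite -/(F t); lra.
have NL2 Z : frob (e *: L2 Z) (e *: L2 Z) <= c * frob Z Z.
  rewrite frob_sqrZ; have [_ _ H] := cL Z.
  by apply: le_trans H; rewrite ler_piMl// frob_ge0.
have Dle t : t \in `[0, T]%R -> frob (D t) (D t) <= kap * e ^+ 2.
  move=> tT.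
  have a0 : 0 <= 18 * c by lra.
  have cf0 : 0 <= 16 * c * f by rewrite !mulr_ge0.
  have b0 := mulr_ge0 cf0 e20.
  have cD : {within `[0, T], continuous D}.
    by apply: continuous_subspaceT; exact: derivable_continuous_mx dD.
  apply: le_trans (energy_estimate a0 b0 D0 cD (fun s _ => dD s) _ tT) _.
  - move=> s sT; have {}sT : s \in `[0, T]%R by exact: subset_itv_oo_cc sT.
    apply: le_trans (frob_sqrD_le _ _) _; have [H0 _ _] := cL (D s).
    rewrite frob_sqrZ.
    have := frob_sqrD_le (L1 (F' s)) (e *: L2 (F' s)).
    have := NL2 (F' s); have [_ H1 _] := cL (F' s) => H2 H3.
    have H4 : frob (L1 (F' s) + e *: L2 (F' s)) (L1 (F' s) + e *: L2 (F' s))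
        <= 4 * c * (2 * frob (D s) (D s) + 2 * f).
      by have := ler_wpM2l c0 (NF' s sT); lra.
    have H5 := ler_wpM2l e20 H4.
    have H6 : e ^+ 2 * (8 * c * frob (D s) (D s)) <= 8 * c * frob (D s) (D s).
      by rewrite ler_piMl// !mulr_ge0// frob_ge0.
    by move: H0 H5 H6; lra.
  - rewrite /kap; move: tT; rewrite in_itv/= => /andP[t0 tT].
    rewrite [leRHS](_ : _ = (16 * c * f * e ^+ 2) * (T * expR ((18 * c + 1) * T))).
      rewrite -mulrA ler_wpM2l// ler_pM ?expR_ge0// ler_expR.
      by rewrite ler_wpM2l// addr_ge0// mulr_ge0.
    ring.
have cQ (L0 : {linear 'M[R]_(n, k) -> 'M[R]_(n, k)}) (U u : R -> 'M[R]_(n, k)) :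
    (forall t : R, is_derive t 1 U (u t)) ->
    continuous (fun t => frob (Q (T - t)) (L0 (U t))).
  by move=> dU; apply: continuous_frob_derivable dQ _ => t; apply: is_derive_lin0 (dU t).
have cM (g : R -> R) a : continuous g -> continuous (fun t => a * g t).
  by move=> cg t; apply: cvgM; [exact: cvg_cst|exact: cg].
pose h t := e * frob (Q (T - t)) (L1 (D t)) + e ^+ 2 * frob (Q (T - t)) (L2 (F' t)).
have ch : continuous h.
  by move=> t; apply: cvgD; apply: cM; [exact: cQ dD|exact: cQ dF'].
have cF := cQ L1 _ _ dF.
have -> : frob W (P' T) - frob W (P T) -
    e * \int[mu]_(t in `[0, T]) frob (Q (T - t)) (L1 (L (P t) + X)) =
  \int[mu]_(t in `[0, T]) h t.
  rewrite (perturbed_duality adj T0 solP' solQ) (duality adj T0 solP solQ).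
  rewrite [X in X - _]addrAC subrr add0r.
  have -> : \int[mu]_(t in `[0, T])
      frob (Q (T - t)) (L' (L' (P' t) + X) - L (L' (P' t) + X)) =
      \int[mu]_(t in `[0, T])
        (h t + e * frob (Q (T - t)) (L1 (L (P t) + X))).
    apply: eq_Rintegral => t _; rewrite /= -/(F' t) -/(F t) L'E /h.
    rewrite -[L _ + _ + _]addrA [L _ + _ - _]addrAC subrr add0r frobDr !frobZr.
    have -> : L1 (F' t) = L1 (D t) + L1 (F t) by rewrite F'E linearD.
    by rewrite frobDr; ring.
  rewrite RintegralD_continuous//; last exact: cM.
  by rewrite RintegralZl_continuous// addrK.
apply: le_trans (Rintegral_norm_le (M := (q + 2 * c * kap + c * f) * e ^+ 2) T0 ch _) _.
  move=> t tT; have Dt := Dle t tT; have Qt := qQ t tT; have [_ H1 _] := cL (D t).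
  have [_ _ H2] := cL (F' t); have H3 := NF' t tT.
  have A1 := frob_AMGM (e *: Q (T - t)) (L1 (D t)).
  have A2 := frob_AMGM (Q (T - t)) (L2 (F' t)).
  rewrite frob_sqrZ frobZl normrM in A1.
  apply: le_trans (ler_normD _ _) _; rewrite normrM [X in _ + X]normrM (ger0_norm e20).
  have B1 := ler_wpM2l c0 Dt; have B2 := ler_wpM2l e20 Qt.
  have B3 := ler_wpM2l c0 H3.
  have B4 : kap * e ^+ 2 <= kap by rewrite ler_piMr.
  have B5 : c * frob (F' t) (F' t) <= c * (2 * kap + 2 * f).
    by apply: le_trans B3 _; rewrite ler_wpM2l//; lra.
  have B6 : e ^+ 2 * (2 * `|frob (Q (T - t)) (L2 (F' t))|) <=
      e ^+ 2 * (q + c * (2 * kap + 2 * f)).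
    by rewrite ler_wpM2l//; lra.
  have B7 := mulr_ge0 c0 (mulr_ge0 kap0 e20).
  lra.
by rewrite mulrAC.
Qed.

End LinearEquation.

(** * Generalized Lyapunov operators *)

Section Lyapunov.
Context {R : realType}.
Implicit Types n k p q : nat.

Lemma lyap_is_linear n k q (K : 'M[R]_q) (A : 'M[R]_n) N (B : 'M[R]_k) M :
  linear (lyap K A N B M).
Proof.
move=> a X Y; rewrite /lyap mulmxDr mulmxDl -scalemxAr -scalemxAl !scalerDr.
rewrite [in RHS]addrACA [in X in _ = X + _]addrACA; congr (_ + _ + _).
rewrite scaler_sumr -big_split; apply: eq_bigr => i _ /=.
rewrite scaler_sumr -big_split; apply: eq_bigr => j _ /=.
rewrite mulmxDr mulmxDl -scalemxAr -scalemxAl scalerDr; congr (_ + _).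
by rewrite !scalerA mulrC.
Qed.

HB.instance Definition _ n k q (K : 'M[R]_q) (A : 'M[R]_n) N (B : 'M[R]_k) M :=
  GRing.isLinear.Build R _ _ _ (lyap K A N B M) (lyap_is_linear K A N B M).

(** Facts about [lyap], in particular linearity and existence of solutions, thus
    apply to the dual equations as well. *)
Lemma lyap_adjE n k q (K : 'M[R]_q) (A : 'M[R]_n) N (B : 'M[R]_k) M :
  lyap_adj K A N B M = lyap K A^T (fun i => (N i)^T) B^T (fun i => (M i)^T).
Proof.
apply/funext => X; rewrite /lyap_adj /lyap trmxK; congr (_ + _).
by apply: eq_bigr => i _; apply: eq_bigr => j _; rewrite trmxK.
Qed.

Lemma frob_lyap_adj n k q (K : 'M[R]_q) (A : 'M[R]_n) N (B : 'M[R]_k) M X Y :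
  frob (lyap K A N B M X) Y = frob X (lyap_adj K A N B M Y).
Proof. by rewrite !frobE lyap_adjP. Qed.

Lemma lyap0 n k q (K : 'M[R]_q) (M : 'I_q -> 'M[R]_k) (X : 'M[R]_(n, k)) :
  lyap K 0 (fun=> 0) 0 M X = 0.
Proof.
rewrite /lyap mul0mx trmx0 mulmx0 addr0 big1 ?addr0// => i _.
by rewrite big1// => j _; rewrite !mul0mx scaler0.
Qed.

Lemma lyap_tr n k q (K : 'M[R]_q) (A : 'M[R]_n) N (B : 'M[R]_k) M X :
  K^T = K -> (lyap K A N B M X)^T = lyap K B M A N X^T.
Proof.
move=> KT; rewrite /lyap !linearD /= !trmx_mul trmxK addrC [in RHS]addrC.
congr (_ + _); last by rewrite addrC.
rewrite linear_sum exchange_big; apply: eq_bigr => i _ /=.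
rewrite linear_sum; apply: eq_bigr => j _ /=.
by rewrite linearZ /= !trmx_mul trmxK mulmxA -{1}KT mxE.
Qed.

(** The operator is at most quadratic in its coefficients, so this expansion has
    no remainder. The linear term is again expressed with [lyap]: each part has
    vanishing drift on the side that is not moved. *)
Lemma lyap_expand n k q (K : 'M[R]_q) (A G : 'M[R]_n) N Gs (B H : 'M[R]_k) M Hs
    (e : R) X :
  lyap K (A + e *: G) (fun i => N i + e *: Gs i)
         (B + e *: H) (fun i => M i + e *: Hs i) X =
  lyap K A N B M X
  + e *: (lyap K 0 N H Hs X + lyap K G Gs 0 M X)
  + e ^+ 2 *: lyap K 0 Gs 0 Hs X.
Proof.
have trDZ (U V : 'M[R]_k) : (U + e *: V)^T = U^T + e *: V^T.
  by apply/matrixP => i j; rewrite !mxE.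
have sumE i j : K i j *: ((N i + e *: Gs i) *m X *m (M j + e *: Hs j)^T) =
    K i j *: (N i *m X *m (M j)^T)
    + (e *: (K i j *: (N i *m X *m (Hs j)^T))
       + e *: (K i j *: (Gs i *m X *m (M j)^T))
       + e ^+ 2 *: (K i j *: (Gs i *m X *m (Hs j)^T))).
  rewrite trDZ !mulmxDl !mulmxDr -!scalemxAl -!scalemxAr.
  rewrite !scalerDr !scalerA -!addrA; congr (_ + _).
  by rewrite ![e * K i j]mulrC ![e ^+ 2 * K i j]mulrC expr2 !mulrA.
have dsumE : \sum_i \sum_j K i j *: ((N i + e *: Gs i) *m X *m (M j + e *: Hs j)^T) =
   \sum_i \sum_j K i j *: (N i *m X *m (M j)^T)
    + (e *: (\sum_i \sum_j K i j *: (N i *m X *m (Hs j)^T))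
       + e *: (\sum_i \sum_j K i j *: (Gs i *m X *m (M j)^T))
       + e ^+ 2 *: (\sum_i \sum_j K i j *: (Gs i *m X *m (Hs j)^T))).
  rewrite !scaler_sumr -!big_split; apply: eq_bigr => i _ /=.
  by rewrite !scaler_sumr -!big_split; apply: eq_bigr => j _ /=.
rewrite /lyap dsumE !trmx0 !mul0mx !mulmx0 !add0r !addr0.
rewrite trDZ mulmxDl mulmxDr -scalemxAl -scalemxAr.
rewrite !scalerDr; set S0 := \sum_i _; set S1 := \sum_i _; set S2 := \sum_i _.
set S3 := \sum_i _.
apply/matrixP => i j; rewrite !mxE; ring.
Qed.

(** The gradient with respect to the drift and diffusion coefficients: this
    turns the first order term of the cost into the integrands of the theorem. *)
Lemma frob_lyap0 n k q (K : 'M[R]_q) (N : 'I_q -> 'M[R]_n) (H : 'M[R]_k) Hs Q F :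
  frob Q (lyap K 0 N H Hs F) = frob (Q^T *m F) H +
    \sum_j frob (Q^T *m (\sum_i K i j *: N i) *m F) (Hs j).
Proof.
have frobQ (V : 'M[R]_n) (W : 'M[R]_k) :
    frob Q (V *m F *m W^T) = frob (Q^T *m V *m F) W.
  rewrite !frobE -[RHS]mxtrace_tr !trmx_mul !trmxK [LHS]mxtrace_mulC.
  by rewrite !mulmxA.
rewrite /lyap mul0mx add0r frobDr; congr (_ + _).
  by have := frobQ 1%:M H; rewrite mul1mx mulmx1.
rewrite exchange_big frobC frob_suml; apply: eq_bigr => j _.
rewrite frob_suml mulmx_sumr mulmx_suml frob_suml; apply: eq_bigr => i _.
by rewrite frobC frobZr -scalemxAr -scalemxAl frobZl frobQ.
Qed.

Lemma mxtrace_frob n k p (C : 'M[R]_(p, n)) (P : 'M[R]_(n, k)) (D : 'M[R]_(p, k)) :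
  \tr (C *m P *m D^T) = frob (C^T *m D) P.
Proof.
rewrite frobE -mxtrace_tr !trmx_mul !trmxK mulmxA.
by rewrite mxtrace_mulC !mulmxA.
Qed.

Lemma affine_sol_uniq n k (L : {linear 'M[R]_(n, k) -> 'M[R]_(n, k)}) X P P' t :
  affine_sol L X P -> affine_sol L X P' -> 0 <= t -> P t = P' t.
Proof. by move=> solP solP' t0; rewrite -(mxint_ivp solP)// (mxint_ivp solP'). Qed.

(** The transposed path solves the same equation. *)
Lemma affine_sol_sym n q (K : 'M[R]_q) (B : 'M[R]_n) M X P t :
  K^T = K -> X^T = X -> affine_sol (lyap K B M B M) X P -> 0 <= t ->
  (P t)^T = P t.
Proof.
move=> KT XT solP t0; have [P0 dP] := solP.
apply: (affine_sol_uniq (P := fun t => (P t)^T) _ solP t0).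
split=> [|s]; first by rewrite P0 linear0.
apply/is_derive_mxP => i j; have /is_derive_mxP /(_ j i) := dP s.
rewrite /= -lyap_tr//.
have -> : ((lyap K B M B M (P s))^T + X) i j = (lyap K B M B M (P s) + X) j i.
  by rewrite -{1}XT !mxE.
by have -> : (fun s => (P s)^T i j) = (fun s => P s j i)
  by apply/funext => s'; rewrite mxE.
Qed.

Lemma linear_coef_eq0 (d S c : R) : 0 < d ->
  (forall e, `|e| < d -> 0 <= e * S + c * e ^+ 2) -> S = 0.
Proof.
move=> d0 H; apply/eqP; case: (eqVneq S 0) => // S0; exfalso.
pose C := `|c| + 1; have C0 : 0 < C by rewrite ltr_wpDl.
have cC : c <= C by rewrite (le_trans (ler_norm c))// lerDl.
have S1 : 0 < `|S| by rewrite normr_gt0.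
have r0 : 0 < d * C + `|S| by rewrite addr_gt0// mulr_gt0.
pose s := d / (d * C + `|S|).
have s0 : 0 < s by rewrite divr_gt0.
have sr : s * (d * C + `|S|) = d by rewrite divfK ?gt_eqF.
(* Test at e = - s * S, with s small enough that |e| < d and s * C < 1. *)
have := H (- (s * S)); rewrite normrN normrM (gtr0_norm s0).
have sS := mulr_gt0 s0 S1; have sdC := mulr_gt0 s0 (mulr_gt0 d0 C0).
have sC : s * C < 1 by rewrite -(ltr_pM2l d0); lra.
have -> : s * `|S| < d by lra.
move=> /(_ isT); apply/negP; rewrite -ltNge.
have -> : - (s * S) * S + c * (- (s * S)) ^+ 2 = s * S ^+ 2 * (c * s - 1) by ring.
have S2 : 0 < S ^+ 2 by rewrite exprn_even_gt0.
rewrite pmulr_rlt0; last exact: mulr_gt0.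
by rewrite subr_lt0 mulrC (le_lt_trans _ sC)// ler_wpM2l// ltW.
Qed.

End Lyapunov.

(** * First order conditions at a local minimum *)

Section FirstOrderConditions.
Context {R : realType} (n nh m p q : nat) (K : 'M[R]_q) (T : R).
Context (A : 'M[R]_n) (N : 'I_q -> 'M[R]_n) (X0 : 'M[R]_(n, m))
  (C : 'M[R]_(p, n)).
Context (Ah : 'M[R]_nh) (Nh : 'I_q -> 'M[R]_nh) (Xh0 : 'M[R]_(nh, m))
  (Ch : 'M[R]_(p, nh)).
Hypotheses (KT : K^T = K) (T0 : 0 < T).
Hypothesis hopt : locally_optimal K T A N X0 C Ah Nh Xh0 Ch.
Local Notation mu := (@lebesgue_measure R).

(** The error bound up to the term that depends on the original system only. *)
Definition reduced_cost (B : 'M[R]_nh) M (Y : 'M[R]_(nh, m))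
    (D : 'M[R]_(p, nh)) : R :=
  frob (D^T *m D) (gramP K B M Y B M Y T)
  - 2 * frob (C^T *m D) (gramP K A N X0 B M Y T).

Lemma locally_optimal_direction H Hs Z E : exists2 d, 0 < d & forall e, `|e| < d ->
  reduced_cost Ah Nh Xh0 Ch <=
  reduced_cost (Ah + e *: H) (fun i => Nh i + e *: Hs i)
    (Xh0 + e *: Z) (Ch + e *: E).
Proof.
have cmp (x y z u v : R) : x - y + z <= x - u + v -> z - y <= v - u.
  lra.
have [d d0 dopt] := hopt.
pose r := 1 + `|H| + \sum_i `|Hs i| + `|Z| + `|E|.
have HH := normr_ge0 H; have ZZ := normr_ge0 Z; have EE := normr_ge0 E.
have HsS : 0 <= \sum_i `|Hs i| by apply: sumr_ge0 => *; exact: normr_ge0.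
have r0 : 0 < r by rewrite /r; lra.
exists (d / r) => [|e ed]; first by rewrite divr_gt0.
have er : `|e| * r < d by rewrite -ltr_pdivlMr.
have small (V : normedModType R) (v : V) : `|v| <= r -> `|e *: v| < d.
  move=> vr; rewrite normrZ; apply: le_lt_trans er.
  by rewrite ler_wpM2l.
have := @dopt (Ah + e *: H) (fun i => Nh i + e *: Hs i) (Xh0 + e *: Z) (Ch + e *: E).
rewrite /error_bound !mxtrace_frob /reduced_cost.
have Hi i : `|Hs i| <= \sum_i `|Hs i|.
  by rewrite (bigD1 i)//= lerDl sumr_ge0.
by move=> H1; apply: cmp; apply: H1 => [|i||]; rewrite addrAC subrr add0r; apply: small;
    rewrite /r; try have := Hi i; lra.
Qed.

Variables (Ph Qh : R -> 'M[R]_nh) (Pt Qt : R -> 'M[R]_(n, nh)).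
Hypotheses (solPh : affine_sol (lyap K Ah Nh Ah Nh) (Xh0 *m Xh0^T) Ph)
  (solPt : affine_sol (lyap K A N Ah Nh) (X0 *m Xh0^T) Pt)
  (solQh : affine_sol (lyap_adj K Ah Nh Ah Nh) (Ch^T *m Ch) Qh)
  (solQt : affine_sol (lyap_adj K A N Ah Nh) (C^T *m Ch) Qt).

Let Ph_sym t : 0 <= t -> (Ph t)^T = Ph t.
Proof.
by apply: (affine_sol_sym KT _ solPh); rewrite trmx_mul trmxK.
Qed.

Let Qh_sym t : 0 <= t -> (Qh t)^T = Qh t.
Proof.
have := solQh; rewrite lyap_adjE => sol.
by apply: (affine_sol_sym KT _ sol); rewrite trmx_mul trmxK.
Qed.

Lemma reduced_costE B M Y D P P' :
  affine_sol (lyap K B M B M) (Y *m Y^T) P ->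
  affine_sol (lyap K A N B M) (X0 *m Y^T) P' ->
  reduced_cost B M Y D = frob (D^T *m D) (P T) - 2 * frob (C^T *m D) (P' T).
Proof.
move=> solP solP'; have T1 := ltW T0.
by rewrite /reduced_cost /gramP (mxint_ivp solP)// (mxint_ivp solP').
Qed.

Let shift0 (V : lmodType R) (v : V) e : v + e *: 0 = v.
Proof. by rewrite scaler0 addr0. Qed.

Let shift0s (V : lmodType R) (v : 'I_q -> V) e : (fun i => v i + e *: 0) = v.
Proof. by apply/funext => i; rewrite shift0. Qed.

(** The Gramians do not depend on [Ch], so the cost is quadratic in it. *)
Lemma optimal_output : Ch *m Ph T = C *m Pt T.
Proof.
apply/matrixP => i j; pose E : 'M[R]_(p, nh) := delta_mx i j.
have [d d0 dopt] := locally_optimal_direction 0 (fun=> 0) 0 E.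
have trE k (V : 'M[R]_(p, k)) (W : 'M[R]_(k, nh)) :
    frob (V^T *m E) W = (V *m W) i j.
  rewrite -frob_delta -/E !frobE -[LHS]mxtrace_tr !trmx_mul !trmxK.
  by rewrite mulmxA mxtrace_mulC mulmxA.
have sym : frob (E^T *m Ch) (Ph T) = (Ch *m Ph T) i j.
  by rewrite -trE -frobT trmx_mul trmxK Ph_sym// ltW.
suff : 2 * ((Ch *m Ph T) i j - (C *m Pt T) i j) = 0.
  by move/eqP; rewrite mulf_eq0 pnatr_eq0/= subr_eq0 => /eqP.
apply: (linear_coef_eq0 (c := frob (E^T *m E) (Ph T)) d0) => e /dopt.
rewrite !shift0 shift0s !(reduced_costE _ solPh solPt) -subr_ge0.
congr (is_true (_ <= _)).
rewrite -!trE mulmxDr -scalemxAr [(_ + _)^T]linearD linearZ /= !mulmxDl !mulmxDr.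
rewrite -!scalemxAl -!scalemxAr !(frobDl, frobZl) sym !trE.
ring.
Qed.

(** The dual Gramians do not depend on [Xh0]; writing the cost with them, by
    [duality], makes it quadratic in [Xh0]. *)
Lemma optimal_initial_state : Qh T *m Xh0 = (Qt T)^T *m X0.
Proof.
have T1 := ltW T0.
apply/matrixP => i j; pose Z : 'M[R]_(nh, m) := delta_mx i j.
have [d d0 dopt] := locally_optimal_direction 0 (fun=> 0) Z 0.
have trZ k (V : 'M[R]_(k, nh)) (W : 'M[R]_(k, m)) :
    frob V (W *m Z^T) = (V^T *m W) i j.
  rewrite -frob_delta -/Z !frobE -[RHS]mxtrace_tr !trmx_mul !trmxK.
  by rewrite [LHS]mxtrace_mulC !mulmxA.
have sym : frob (Qh T) (Z *m Xh0^T) = ((Qh T)^T *m Xh0) i j.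
  by rewrite -trZ -frobT trmx_mul trmxK Qh_sym.
suff : 2 * (((Qh T)^T *m Xh0) i j - ((Qt T)^T *m X0) i j) = 0.
  move/eqP; rewrite mulf_eq0 pnatr_eq0/= subr_eq0 => /eqP.
  by rewrite Qh_sym.
apply: (linear_coef_eq0 (c := frob (Qh T) (Z *m Z^T)) d0) => e /dopt.
have [Ph' solPh'] := affine_sol_exists (lyap K Ah Nh Ah Nh)
  ((Xh0 + e *: Z) *m (Xh0 + e *: Z)^T).
have [Pt' solPt'] := affine_sol_exists (lyap K A N Ah Nh)
  (X0 *m (Xh0 + e *: Z)^T).
rewrite !shift0 shift0s (reduced_costE _ solPh solPt) (reduced_costE _ solPh' solPt').
rewrite (duality (frob_lyap_adj K Ah Nh Ah Nh) T1 solPh solQh).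
rewrite (duality (frob_lyap_adj K Ah Nh Ah Nh) T1 solPh' solQh).
rewrite (duality (frob_lyap_adj K A N Ah Nh) T1 solPt solQt).
rewrite (duality (frob_lyap_adj K A N Ah Nh) T1 solPt' solQt) -subr_ge0.
congr (is_true (_ <= _)).
rewrite [(_ + _)^T]linearD linearZ /= !mulmxDl !mulmxDr.
rewrite -!scalemxAl -!scalemxAr !(frobDr, frobZr) sym !trZ.
ring.
Qed.

Local Notation Fh t := (lyap K Ah Nh Ah Nh (Ph t) + Xh0 *m Xh0^T).
Local Notation Ft t := (lyap K A N Ah Nh (Pt t) + X0 *m Xh0^T).

Let Fh_sym t : 0 <= t -> (Fh t)^T = Fh t.
Proof.
by move=> t0; rewrite [LHS]linearD /= lyap_tr// Ph_sym// trmx_mul trmxK.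
Qed.

(** Stationarity in [Ah] and all [Nh i] together, before a direction is chosen.
    The right factors of the two operators vary in the same way, which gives the
    two sides; the left factor of the hatted one varies too, and contributes the
    transpose of the same expression. As [Fh] and [Qh] are symmetric this doubles
    the left side, and cancels the factor [2] of the mixed term. *)
Lemma optimal_dynamics H Hs :
  \int[mu]_(t in `[0, T]) frob (Qh (T - t)) (lyap K 0 Nh H Hs (Fh t)) =
  \int[mu]_(t in `[0, T]) frob (Qt (T - t)) (lyap K 0 N H Hs (Ft t)).
Proof.
have T1 := ltW T0.
have combine (a a' b b' e Sh St ct ch : R) :
    `|a' - a - e * St| <= ct * e ^+ 2 ->
    `|b' - b - e * (2 * Sh)| <= ch * e ^+ 2 ->
    b - 2 * a <= b' - 2 * a' ->
    0 <= e * (2 * (Sh - St)) + (ch + 2 * ct) * e ^+ 2.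
  by rewrite !ler_norml => /andP[H1 _] /andP[_ H2] H3; lra.
have [d d0 dopt] := locally_optimal_direction H Hs 0 0.
have [ch chP] := @first_order_expansion _ _ _ (lyap K Ah Nh Ah Nh)
  (lyap K 0 Nh H Hs \+ lyap K H Hs 0 Nh) (lyap K 0 Hs 0 Hs) _ _ _ _ _ _
  (frob_lyap_adj K Ah Nh Ah Nh) T1 solPh solQh.
have [ct ctP] := @first_order_expansion _ _ _ (lyap K A N Ah Nh)
  (lyap K 0 N H Hs) (lyap K 0 (fun=> 0) 0 Hs) _ _ _ _ _ _
  (frob_lyap_adj K A N Ah Nh) T1 solPt solQt.
set Sh := LHS; set St := RHS.
have ShE : \int[mu]_(t in `[0, T]) frob (Qh (T - t))
    ((lyap K 0 Nh H Hs \+ lyap K H Hs 0 Nh) (Fh t)) = 2 * Sh.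
  rewrite -RintegralZl_continuous; last first.
    apply: continuous_frob_derivable (affine_sol_rev T solQh) _ => t.
    exact: is_derive_lin0 (is_derive_affine_sol solPh t).
  apply: eq_Rintegral => t; rewrite inE/= in_itv/= => /andP[t0 tT].
  have -> : lyap K H Hs 0 Nh (Fh t) = (lyap K 0 Nh H Hs (Fh t))^T.
    by rewrite lyap_tr// Fh_sym.
  by rewrite frobDr -[X in _ + X]frobT trmxK Qh_sym ?subr_ge0//; ring.
rewrite ShE -/St in chP ctP.
suff : 2 * (Sh - St) = 0.
  by move/eqP; rewrite mulf_eq0 pnatr_eq0/= subr_eq0 => /eqP.
have d1 : 0 < Num.min d 1 by rewrite lt_min d0 ltr01.
apply: (linear_coef_eq0 (c := ch + 2 * ct) d1) => e.
rewrite lt_min => /andP[/dopt + /ltW e1].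
pose Ah' := Ah + e *: H; pose Nh' i := Nh i + e *: Hs i.
have [Ph' solPh'] := affine_sol_exists (lyap K Ah' Nh' Ah' Nh') (Xh0 *m Xh0^T).
have [Pt' solPt'] := affine_sol_exists (lyap K A N Ah' Nh') (X0 *m Xh0^T).
rewrite !shift0 (reduced_costE _ solPh solPt) (reduced_costE _ solPh' solPt').
apply: combine.
  apply: (ctP e e1 (lyap K A N Ah' Nh') Pt' _ solPt') => V.
  have := lyap_expand K A 0 N (fun=> 0) Ah H Nh Hs e V.
  by rewrite shift0 shift0s lyap0 addr0.
apply: (chP e e1 (lyap K Ah' Nh' Ah' Nh') Ph' _ solPh') => V.
exact: lyap_expand.
Qed.

Lemma optimal_drift :
  mxint 0 T (fun t => Qh (T - t) *m Fh t) =
  mxint 0 T (fun t => (Qt (T - t))^T *m Ft t).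
Proof.
apply/matrixP => a b; have := optimal_dynamics (delta_mx a b) (fun=> 0).
rewrite !mxE; under eq_Rintegral => t tT.
  rewrite frob_lyap0 frob_delta big1 ?addr0; last by move=> *; rewrite frob0r.
  rewrite Qh_sym; last by move: tT; rewrite inE/= in_itv/= subr_ge0 => /andP[].
  over.
move=> ->; apply: eq_Rintegral => t _.
by rewrite frob_lyap0 frob_delta big1 ?addr0// => *; rewrite frob0r.
Qed.

Lemma optimal_diffusion i :
  mxint 0 T (fun t => Qh (T - t) *m (\sum_(j < q) K i j *: Nh j) *m Fh t) =
  mxint 0 T (fun t => (Qt (T - t))^T *m (\sum_(j < q) K i j *: N j) *m Ft t).
Proof.
have KTij (V : lmodType R) (v : 'I_q -> V) :
    \sum_j K j i *: v j = \sum_j K i j *: v j.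
  by apply: eq_bigr => j _; rewrite -{1}KT mxE.
have sum1 (V : 'I_q -> 'M[R]_nh) a b :
    \sum_j frob (V j) (if j == i then delta_mx a b else 0) = V i a b.
  rewrite (bigD1 i)//= eqxx frob_delta big1 ?addr0// => j /negPf ->.
  by rewrite frob0r.
apply/matrixP => a b.
have := optimal_dynamics 0 (fun j => if j == i then delta_mx a b else 0).
rewrite !mxE; under eq_Rintegral => t tT.
  rewrite frob_lyap0 frob0r add0r sum1 KTij.
  rewrite Qh_sym; last by move: tT; rewrite inE/= in_itv/= subr_ge0 => /andP[].
  over.
move=> ->; apply: eq_Rintegral => t _.
by rewrite frob_lyap0 frob0r add0r sum1 KTij.
Qed.

End FirstOrderConditions.

Theorem theorem3p1 (R : realType) (n nh m p q : nat)
    (K : 'M[R]_q) (hK : is_covariance K) (T : R) (hT : 0 < T)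
    (A : 'M[R]_n) (N : 'I_q -> 'M[R]_n) (X0 : 'M[R]_(n, m)) (C : 'M[R]_(p, n))
    (Ah : 'M[R]_nh) (Nh : 'I_q -> 'M[R]_nh) (Xh0 : 'M[R]_(nh, m))
    (Ch : 'M[R]_(p, nh))
    (hL : bijective (lyap K A N A N))
    (hLh : bijective (lyap K Ah Nh Ah Nh))
    (hopt : locally_optimal K T A N X0 C Ah Nh Xh0 Ch) :
  let Fh := covF K Ah Nh Xh0 Ah Nh Xh0 in
  let Ft := covF K A N X0 Ah Nh Xh0 in
  let Ph := gramP K Ah Nh Xh0 Ah Nh Xh0 in
  let Pt := gramP K A N X0 Ah Nh Xh0 in
  let Qh := gramQ K Ah Nh Ch Ah Nh Ch in
  let Qt := gramQ K A N C Ah Nh Ch in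
  [/\ Ch *m Ph T = C *m Pt T,
      Qh T *m Xh0 = (Qt T)^T *m X0,
      mxint 0 T (fun t => Qh (T - t) *m Fh t)
        = mxint 0 T (fun t => (Qt (T - t))^T *m Ft t) &
      forall i : 'I_q,
        mxint 0 T (fun t => Qh (T - t) *m (\sum_(j < q) K i j *: Nh j) *m Fh t)
        = mxint 0 T
            (fun t => (Qt (T - t))^T *m (\sum_(j < q) K i j *: N j) *m Ft t)].
Proof.
move=> Fh Ft Ph Pt Qh Qt; have [KT _] := hK; have T0 := ltW hT.
have [Ph' solPh] := affine_sol_exists (lyap K Ah Nh Ah Nh) (Xh0 *m Xh0^T).
have [Pt' solPt] := affine_sol_exists (lyap K A N Ah Nh) (X0 *m Xh0^T).
have [Qh' solQh] : exists Q, affine_sol (lyap_adj K Ah Nh Ah Nh) (Ch^T *m Ch) Q.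
  by rewrite lyap_adjE; exact: affine_sol_exists.
have [Qt' solQt] : exists Q, affine_sol (lyap_adj K A N Ah Nh) (C^T *m Ch) Q.
  by rewrite lyap_adjE; exact: affine_sol_exists.
have QhE s : 0 <= s -> Qh s = Qh' s.
  by move: solQh; rewrite /Qh /gramQ /covG lyap_adjE; exact: mxint_ivp.
have QtE s : 0 <= s -> Qt s = Qt' s.
  by move: solQt; rewrite /Qt /gramQ /covG lyap_adjE; exact: mxint_ivp.
have PhE : Ph T = Ph' T := mxint_ivp solPh T0.
have PtE : Pt T = Pt' T := mxint_ivp solPt T0.
have FhE t : 0 <= t -> Fh t = lyap K Ah Nh Ah Nh (Ph' t) + Xh0 *m Xh0^T.
  exact: ivpE solPh.
have FtE t : 0 <= t -> Ft t = lyap K A N Ah Nh (Pt' t) + X0 *m Xh0^T.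
  exact: ivpE solPt.
split.
- by rewrite PhE PtE; exact: (optimal_output KT hT hopt solPh solPt).
- rewrite QhE// QtE//.
  exact: (optimal_initial_state KT hT hopt solPh solPt solQh solQt).
- have := optimal_drift KT hT hopt solPh solPt solQh solQt.
  congr (_ = _); apply: eq_mxint => t; rewrite in_itv/= => /andP[t0 tT].
    by rewrite QhE ?subr_ge0// FhE.
  by rewrite QtE ?subr_ge0// FtE.
- move=> i; have := optimal_diffusion KT hT hopt solPh solPt solQh solQt i.
  congr (_ = _); apply: eq_mxint => t; rewrite in_itv/= => /andP[t0 tT].
    by rewrite QhE ?subr_ge0// FhE.
  by rewrite QtE ?subr_ge0// FtE.
Qed.
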